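(* There exists a distance $d$ on $\mathbb R^2$ that is homogeneous with respect to the dilations $\delta_\lambda(x,y)=(\lambda^2x,\lambda^2y)$, $\lambda>0$, and whose unit sphere $\{p\in\mathbb R^2:d(0,p)=1\}$ has Euclidean Hausdorff dimension $\frac32$.
   Context: Here $\mathbb R^2$ is the additive group. A distance $d$ on $\mathbb R^2$ is homogeneous with respect to $\{\delta_\lambda\}_{\lambda>0}$ if it is translation-invariant, i.e. $d(g+x,g+y)=d(x,y)$ for all $g,x,y$, and $d(\delta_\lambda x,\delta_\lambda y)=\lambda d(x,y)$ for all $\lambda>0$ and all $x,y\in\mathbb R^2$. *)

(* Defs.v *)
From HB Require Import structures.
From mathcomp Require Import all_boot all_order all_algebra.
From mathcomp Require Import all_classical all_reals all_analysis.

Set Implicit Arguments.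
Unset Strict Implicit.
Unset Printing Implicit Defensive.

Import Order.TTheory GRing.Theory Num.Theory.
Local Open Scope classical_set_scope.
Local Open Scope ring_scope.

Section Distances.
Context {R : realType}.

Definition is_distance {T : Type} (d : T -> T -> R) : Prop :=
  [/\ forall x y, 0 <= d x y,
      forall x y, d x y = 0 <-> x = y,
      forall x y, d x y = d y x &
      forall x y z, d x z <= d x y + d y z].

Definition homogeneous_distance {G : zmodType} (delta : R -> G -> G)
    (d : G -> G -> R) : Prop :=
  [/\ is_distance d,
      forall g x y, d (g + x) (g + y) = d x y &
      forall (lambda : R) x y, 0 < lambda ->
        d (delta lambda x) (delta lambda y) = lambda * d x y].

Definition unit_sphere {G : zmodType} (d : G -> G -> R) : set G :=
  [set p | d 0 p = 1].

Definition square_dilation (lambda : R) (p : R * R) : R * R :=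
  (lambda ^+ 2 * p.1, lambda ^+ 2 * p.2).

Definition euclidean_distance (p q : R * R) : R :=
  Num.sqrt ((p.1 - q.1) ^+ 2 + (p.2 - q.2) ^+ 2).

End Distances.

Section Hausdorff.
Context {R : realType} {T : Type} (d : T -> T -> R).
Local Open Scope ereal_scope.

(* The maximum with 0 only matters for the empty set, whose supremum in
   [\bar R] would otherwise be [-oo]. *)
Definition diameter (U : set T) : \bar R :=
  maxe 0 (ereal_sup [set r | exists x y, [/\ U x, U y & r = (d x y)%:E]]).

(* [poweR 0 0 = 1], so for [s = 0] this is 1 on nonempty sets, and the case
   distinction makes it 0 on the empty set: the 0-dimensional Hausdorff measure
   is the counting measure. *)
Definition diameter_power (s : R) (U : set T) : \bar R :=
  if U == set0 then 0 else poweR (diameter U) s.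

(* Sequences suffice for countable covers, as the [U k] may be empty. *)
Definition hausdorff_premeasure (s eps : R) (A : set T) : \bar R :=
  ereal_inf [set r | exists U : nat -> set T,
    [/\ A `<=` \bigcup_k U k,
        forall k, diameter (U k) <= eps%:E &
        r = \sum_(0 <= k <oo) diameter_power s (U k)]].

Definition hausdorff_measure (s : R) (A : set T) : \bar R :=
  ereal_sup [set hausdorff_premeasure s eps A | eps in [set eps : R | (0 < eps)%R]].

Definition hausdorff_dimension (A : set T) : \bar R :=
  ereal_inf [set s%:E | s in [set s : R | (0 <= s)%R /\ hausdorff_measure s A = 0]].

End Hausdorff.

(* Main.v *)
Require Import Defs.
From HB Require Import structures.
From mathcomp Require Import all_boot all_order all_algebra.
From mathcomp Require Import all_classical all_reals all_analysis.
From mathcomp Require Import zify ring lra.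

(* Let [f] be the first coordinate of Peano's curve: it is 1/2-Hölder, and on
   each 9-adic interval of generation [n] it spreads Lebesgue measure evenly over
   a triadic interval of generation [n], so a square of side [9^-n] contains a
   part of the graph lying over a set of measure at most a constant times
   [27^-n = (9^-n)^(3/2)].
   With [M] the sup norm, put [N = sqrt M + W / 20], where
   [W (x, y) = sqrt |x| * f (min(|x|, |y|) / |x|)] is homogeneous of degree 1/2,
   even and 1/2-Hölder; as [sqrt (a + b) <= sqrt a + sqrt b / 2] for [b <= a], the
   slack in the subadditivity of [sqrt M] absorbs the variation of [W], and [N] is
   subadditive.  The sphere [N = 1] contains a Lipschitz-equivalent copy of
   the graph of [f], so the mass distribution principle bounds its dimension below by 3/2.
   For the upper bound, the sphere is the radial graph of a 1/2-Hölder function on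
   the boundary of a square: [O(n^2)] arcs of length [n^-2], over each of which the
   radius oscillates by [O(1/n)], cut it into [O(n^3)] sets of diameter [O(n^-2)]. *)

Import Order.TTheory GRing.Theory Num.Theory.

(** * Peano's curve on 9-adic intervals *)

(* The first coordinate of Peano's curve maps the [j]-th 9-adic interval of
   generation [n] onto the triadic interval of index [peano_index n j], traversed
   downwards when [j + peano_index n j] is odd.  Starting from [0] for every [j],
   the function is extended to the half line by reflections. *)
Fixpoint peano_index (n j : nat) : nat :=
  if n is n'.+1 then
    let i := (j %/ 9)%N in let k := peano_index n' i in
    (3 * k + (if odd (i + k) then 2 - j %% 9 %/ 3 else j %% 9 %/ 3))%N
  else 0%N.

Lemma peano_indexS n i e : (e < 9)%N ->
  peano_index n.+1 (9 * i + e) = (3 * peano_index n i +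
    (if odd (i + peano_index n i) then 2 - e %/ 3 else e %/ 3))%N.
Proof.
move=> lte9 /=.
have -> : ((9 * i + e) %/ 9 = i)%N by lia.
by have -> : ((9 * i + e) %% 9 = e)%N by lia.
Qed.

(** An interval ends where the next one begins, so the index can only stay or move by one in the
    direction of traversal. The sign is part of the statement because the induction needs it: at the
    end of a block it says on which side the next parent lies. *)
Lemma peano_index_step n i :
  if odd (i + peano_index n i)
  then peano_index n i.+1 = peano_index n i \/ (peano_index n i.+1).+1 = peano_index n i
  else peano_index n i.+1 = peano_index n i \/ peano_index n i.+1 = (peano_index n i).+1.
Proof.
elim: n i => [|n IHn] j; first by case: ifP => _; left.
have [i [e [lte9 ->]]] : exists i e, (e < 9)%N /\ j = (9 * i + e)%N.
  by exists (j %/ 9)%N, (j %% 9)%N; lia.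
move: (IHn i); rewrite (peano_indexS n i _ lte9).
have [e8|ne8] := eqVneq e 8; last first.
  rewrite -addnS peano_indexS; last by lia.
  move: (peano_index n i) => a _.
  have : e \in iota 0 8 by rewrite mem_iota; lia.
  by do 8?[rewrite in_cons => /predU1P[->|]] => //;
     case p: (odd (i + a)); case: ifP => /=; lia.
(* After the last child the successor carries into the next block, and the induction hypothesis on
   the parents decides. *)
have -> : ((9 * i + e).+1 = 9 * i.+1 + 0)%N by lia.
rewrite peano_indexS // e8.
move: (peano_index n i) (peano_index n i.+1) => a b.
by case p: (odd (i + a)) => - [] E; case q: (odd (i.+1 + b));
   case: ifP => /=; lia.
Qed.

Lemma big_nat_mul9 (g : nat -> nat) a k :
  (\sum_(9 * a <= j < 9 * (a + k)) g j =
   \sum_(a <= j < a + k) \sum_(e < 9) g (9 * j + e))%N.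
Proof.
elim: k => [|k IHk]; first by rewrite addn0 !big_geq.
rewrite addnS [RHS]big_nat_recr ?leq_addr //= -IHk.
rewrite (big_cat_nat (n := (9 * (a + k))%N)) /=; [|lia|lia].
congr addn; rewrite -{1}[(9 * (a + k))%N]add0n big_addn.
have -> : (9 * (a + k).+1 - 9 * (a + k) = 9)%N by lia.
by rewrite big_mkord; apply: eq_bigr => e _; rewrite addnC.
Qed.

(** This is the even spreading of mass. The index [c] forces the parent to have index [c %/ 3] and
    the new ternary digit to be [c %% 3]; in either direction of traversal, exactly three of the
    nine children have that digit. *)
Lemma peano_index_count n m i c :
  (\sum_(9 ^ m * i <= j < 9 ^ m * i.+1) (peano_index (n + m) j == c) <= 3 ^ m)%N.
Proof.
elim: m c => [|m IHm] c.
  by rewrite !expn0 !mul1n big_nat1; case: eqP.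
have -> : (9 ^ m.+1 * i = 9 * (9 ^ m * i))%N by rewrite expnS mulnA.
have -> : (9 ^ m.+1 * i.+1 = 9 * (9 ^ m * i + 9 ^ m))%N.
  by rewrite expnS -mulnA mulnS addnC.
rewrite big_nat_mul9 [X in (X <= _)%N](_ : _ =
  \sum_(9 ^ m * i <= j < 9 ^ m * i.+1) \sum_(e < 9)
    (peano_index (n + m.+1) (9 * j + e) == c))%N;
  last first.
  by rewrite mulnS addnC.
rewrite expnS (leq_trans _ (leq_mul (leqnn 3) (IHm (c %/ 3)%N))) //.
rewrite big_distrr /= leq_sum // => j _.
rewrite addnS (eq_bigr _ (fun (e : 'I_9) _ => congr1 (fun k => nat_of_bool (k == c))
  (peano_indexS _ _ _ (ltn_ord e)))).
have digit x : (x < 3)%N -> ((3 * peano_index (n + m) j + x == c) : nat) =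
    ((peano_index (n + m) j == c %/ 3) * (x == c %% 3))%N.
  by move=> ltx3; rewrite mulnb; congr nat_of_bool; lia.
have ltd e : (e < 9)%N -> (e %/ 3 < 3)%N by lia.
rewrite (eq_bigr (fun e : 'I_9 => (peano_index (n + m) j == c %/ 3) *
  ((if odd (j + peano_index (n + m) j) then 2 - e %/ 3 else e %/ 3) == c %% 3)))%N;
  last first.
  by move=> e _; apply: digit; case: ifP => _; have := ltd _ (ltn_ord e); lia.
rewrite -big_distrr /= [(3 * _)%N]mulnC leq_mul2l; apply/orP; right.
rewrite !big_ord_recl big_ord0.
by case: (odd _); case: (c %% 3)%N (ltn_pmod c (isT : 0 < 3)%N) => [|[|[|]]].
Qed.

Lemma peano_index_count_window n m i k c l :
  (\sum_(9 ^ m * i <= j < 9 ^ m * (i + k))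
     (c <= peano_index (n + m) j < c + l) <= k * l * 3 ^ m)%N.
Proof.
elim: l => [|l IHl].
  by rewrite addn0 big1 // => j _; case: leqP.
have IHk : (\sum_(9 ^ m * i <= j < 9 ^ m * (i + k))
    (peano_index (n + m) j == c + l) <= k * 3 ^ m)%N.
  elim: k {IHl} => [|k IHk]; first by rewrite addn0 big_geq.
  rewrite (big_cat_nat (n := (9 ^ m * (i + k))%N)) ?leq_mul2l ?leq_add2l ?leqnSn
    ?leq_addr ?orbT //=.
  rewrite mulSn addnC leq_add // addnS; exact: peano_index_count.
have -> : (k * l.+1 * 3 ^ m = k * l * 3 ^ m + k * 3 ^ m)%N.
  by rewrite mulnS mulnDl addnC.
apply: leq_trans (leq_add IHl IHk).
rewrite -big_split /= leq_sum // => j _.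
by move: (peano_index _ _) => a; lia.
Qed.

Local Open Scope classical_set_scope.
Local Open Scope ring_scope.

(** * The Peano coordinate function *)

Section PeanoFunction.
Context {R : realType}.
Implicit Types u v : R.

Lemma truncn_divn (k : nat) (x : R) : (0 < k)%N -> 0 <= x ->
  (Num.truncn (k%:R * x) %/ k)%N = Num.truncn x.
Proof.
move=> k0 x0; have kR : 0 < k%:R :> R by rewrite ltr0n.
have kx0 : 0 <= k%:R * x by rewrite mulr_ge0 // ltW.
apply/esym/truncn_def; apply/andP; split.
  rewrite -(ler_pM2l kR) -natrM (le_trans _ (proj1 (andP (truncn_itv kx0)))) //.
  by rewrite ler_nat mulnC leq_trunc_div.
rewrite -(ltr_pM2l kR) -natrM (lt_le_trans (proj2 (andP (truncn_itv kx0)))) //.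
by rewrite ler_nat mulnC ltn_ceil.
Qed.

Definition peano_column (n : nat) u : nat :=
  peano_index n (Num.truncn (9 ^+ n * u)).

Lemma peano_columnS n u : 0 <= u ->
  (3 * peano_column n u <= peano_column n.+1 u <= 3 * peano_column n u + 2)%N.
Proof.
move=> u0; rewrite /peano_column /= exprS -mulrA (truncn_divn 9) //; last first.
  by rewrite mulr_ge0 // exprn_ge0.
have := ltn_pmod (Num.truncn (9%:R * (9 ^+ n * u))) (isT : 0 < 9)%N.
by move: (_ %% _)%N (peano_index _ _) => e a e9; case: ifP => _; lia.
Qed.

(** The triadic intervals attached to [u] are nested, so every left end lies below every right end;
    hence their left ends have a supremum lying in all of them. *)
Lemma peano_column_nested n m u : 0 <= u ->
  (peano_column n u)%:R / 3 ^+ n <= ((peano_column m u).+1)%:R / 3 ^+ m :> R.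
Proof.
move=> u0.
have lo : {homo (fun k => (peano_column k u)%:R / 3 ^+ k : R) : i j / (i <= j)%N >-> i <= j}.
  apply/nondecreasing_seqP => k; rewrite exprS invfM mulrA ler_pM2r ?invr_gt0 ?exprn_gt0 //.
  rewrite ler_pdivlMr // -natrM ler_nat mulnC.
  by case/andP: (peano_columnS k u u0).
have hi : {homo (fun k => ((peano_column k u).+1)%:R / 3 ^+ k : R) :
    i j / (i <= j)%N >-> j <= i}.
  apply/nonincreasing_seqP => k; rewrite exprS invfM mulrA ler_pM2r ?invr_gt0 ?exprn_gt0 //.
  rewrite ler_pdivrMr // -natrM ler_nat mulnC.
  by case/andP: (peano_columnS k u u0); lia.
have lohi k : (peano_column k u)%:R / 3 ^+ k <= ((peano_column k u).+1)%:R / 3 ^+ k :> R.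
  by rewrite ler_pM2r ?invr_gt0 ?exprn_gt0 // ler_nat.
case: (leqP n m) => nm; first exact: le_trans (lo _ _ nm) (lohi m).
exact: le_trans (lohi n) (hi _ _ (ltnW nm)).
Qed.

Definition peano_fun u : R :=
  sup (range (fun n : nat => (peano_column n u)%:R / 3 ^+ n)).

Lemma peano_fun_column n u : 0 <= u ->
  (peano_column n u)%:R <= 3 ^+ n * peano_fun u <= (peano_column n u).+1%:R.
Proof.
move=> u0; have p3 : 0 < 3 ^+ n :> R by rewrite exprn_gt0.
rewrite /peano_fun mulrC; apply/andP; split.
  rewrite -ler_pdivrMr //; apply: ub_le_sup; last by exists n.
  by exists ((peano_column n u).+1%:R / 3 ^+ n) => _ [k _ <-]; exact: peano_column_nested.
rewrite -ler_pdivlMr //; apply: ge_sup; first by exists ((peano_column n u)%:R / 3 ^+ n), n.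
by move=> _ [k _ <-]; exact: peano_column_nested.
Qed.

Lemma peano_fun_itv u : 0 <= u -> 0 <= peano_fun u <= 1.
Proof. by move=> /(peano_fun_column 0); rewrite expr0 mul1r. Qed.

Lemma truncn_near (x y : R) : 0 <= x -> 0 <= y -> x <= y -> y - x <= 1 ->
  Num.truncn y = Num.truncn x \/ Num.truncn y = (Num.truncn x).+1.
Proof.
move=> x0 y0 xy yx1; have := le_truncn xy.
have : (Num.truncn y <= (Num.truncn x).+1)%N.
  rewrite truncn_le_nat; have /andP[_] := truncn_itv x0.
  by rewrite -[X in _ -> _ < X]natr1; lra.
lia.
Qed.

(** Such points lie in the same or in adjacent 9-adic intervals, so their values lie in the same or
    in adjacent triadic intervals of length [3^-n]. *)
Lemma peano_fun_scale n u v : 0 <= u -> 0 <= v -> `|u - v| <= (9 ^+ n)^-1 ->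
  `|peano_fun u - peano_fun v| <= 2 / 3 ^+ n.
Proof.
wlog uv : u v / u <= v => [H u0 v0|].
  case: (leP u v) => [|/ltW] uv; first exact: H.
  by rewrite distrC [X in _ -> X <= _]distrC; exact: H.
move=> u0 v0; rewrite distrC ger0_norm ?subr_ge0 // => d.
have p3 : 0 < 3 ^+ n :> R by rewrite exprn_gt0.
have p9 : 0 < 9 ^+ n :> R by rewrite exprn_gt0.
have := peano_fun_column n u u0; have := peano_fun_column n v v0.
rewrite -(ler_pM2l p9) mulrV ?unitfE ?gt_eqF // mulrBr in d.
have := truncn_near (9 ^+ n * u) (9 ^+ n * v).
move=> /(_ (mulr_ge0 (ltW p9) u0) (mulr_ge0 (ltW p9) v0)).
rewrite ler_pM2l // => /(_ uv d); rewrite /peano_column.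
set i := Num.truncn (_ * u) => near.
rewrite ler_pdivlMr //.
have -> : `|peano_fun u - peano_fun v| * 3 ^+ n =
    `|3 ^+ n * peano_fun u - 3 ^+ n * peano_fun v|.
  by rewrite -mulrBr normrM (ger0_norm (ltW p3)) mulrC.
have : peano_index n (Num.truncn (9 ^+ n * v)) = peano_index n i \/
   peano_index n (Num.truncn (9 ^+ n * v)) = (peano_index n i).+1 \/
   (peano_index n (Num.truncn (9 ^+ n * v))).+1 = peano_index n i.
  case: near => ->; first by left.
  by have := peano_index_step n i; case: ifP => _; lia.
move: (peano_index _ _) (peano_index _ _) => a b ab /andP[h1 h2] /andP[h3 h4].
have ba : (b%:R <= a%:R + 1 :> R) /\ (a%:R <= b%:R + 1 :> R).
  by rewrite !natr1 !ler_nat; lia.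
rewrite -(natr1 b) in h2; rewrite -(natr1 a) in h4; rewrite ler_norml.
move: (_ * peano_fun u) (_ * peano_fun v) ba h1 h2 h3 h4 => {d} A B []; lra.
Qed.

Lemma pow9_scale (x : R) : 0 < x <= 1 -> exists n, (9 ^+ n.+1)^-1 < x <= (9 ^+ n)^-1.
Proof.
move=> /andP[x0 x1].
have ex : exists n, (9 ^+ n)^-1 < x.
  exists (Num.truncn x^-1); rewrite invf_plt ?posrE ?exprn_gt0 //.
  apply: lt_le_trans (truncnS_gt _) _.
  by rewrite -natrX ler_nat; exact: ltn_expl.
case: (ex_minnP ex) => -[|n] h m.
  by rewrite expr0 invr1 in h; lra.
exists n; rewrite h /= leNgt; apply/negP => /m; lia.
Qed.

Lemma peano_fun_holder u v : 0 <= u -> 0 <= v ->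
  `|peano_fun u - peano_fun v| <= 6 * Num.sqrt `|u - v|.
Proof.
move=> u0 v0; have [->|uv] := eqVneq u v; first by rewrite !subrr !normr0 sqrtr0 mulr0.
have /andP[fu0 fu1] := peano_fun_itv u u0; have /andP[fv0 fv1] := peano_fun_itv v v0.
have [d1|d1] := leP `|u - v| 1; last first.
  apply: (@le_trans _ _ (6 * Num.sqrt 1)); last first.
    by rewrite ler_pM2l // ler_sqrt // ltW.
  rewrite sqrtr1 ler_norml; lra.
have d0 : 0 < `|u - v| by rewrite normr_gt0 subr_eq0.
have [n /andP[lo hi]] := pow9_scale `|u - v| (introT andP (conj d0 d1)).
apply: le_trans (peano_fun_scale n u v u0 v0 hi) _.
(* The constant 6 is 2 times the factor 3 lost in rounding [|u - v|] up to a power of 1/9. *)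
have -> : 2 / 3 ^+ n = 6 * Num.sqrt ((9 ^+ n.+1)^-1) :> R.
  have -> : (9 ^+ n.+1)^-1 = ((3 ^+ n.+1)^-1) ^+ 2 :> R.
    by rewrite exprVn -exprM mulnC exprM; congr (_ ^+ _)^-1; rewrite expr2 -natrM.
  rewrite sqrtr_sqr ger0_norm ?invr_ge0 ?exprn_ge0 // exprS invfM mulrA.
  by congr (_ * _); field.
by rewrite ler_pM2l // ler_sqrt // ltW.
Qed.

End PeanoFunction.

(** * Measure of the set over which the graph stays in a small square *)

Section PeanoMass.
Context {R : realType}.
Implicit Types E V : set R.
Local Notation mu := (@lebesgue_measure R).

Lemma measure_bigsetU_itv (s : seq nat) (q : R) : 0 < q ->
  exists V, [/\ measurable V,
    forall j u, j \in s -> j%:R <= q * u <= j.+1%:R -> V u &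
    (mu V <= ((size s)%:R / q)%:E)%E].
Proof.
move=> q0; pose I (k : nat) : set R := `[(nth 0 s k)%:R / q, (nth 0 s k).+1%:R / q]%classic.
have mI k : measurable (I k) by exact: measurable_itv.
have mV : measurable (\big[setU/set0]_(k < size s) I k).
  by apply: bigsetU_measurable => k _; exact: mI.
exists (\big[setU/set0]_(k < size s) I k); split => //.
- move=> j u js ju; rewrite -bigcup_mkord; exists (index j s); first by rewrite /= index_mem.
  rewrite /I /= nth_index // in_itv /= ler_pdivrMr // ler_pdivlMr //.
  by rewrite ![_ * q]mulrC.
- have muI k : (mu (I k) <= (q^-1)%:E)%E.
    rewrite lebesgue_measure_itv /=; case: ifP => _; last by rewrite lee_fin invr_ge0 ltW.
    by rewrite -EFinD lee_fin -mulrBl -natrB // subSnn mul1r.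
  have := @content_subadditive _ _ _ mu _ I (size s) (fun k _ => mI k).
  move=> /(_ (\big[setU/set0]_(k < size s) I k)) h.
  apply: (le_trans (h mV _)) => //.
  apply: (@le_trans _ _ (\sum_(k < size s) (q^-1)%:E)%E).
    by apply: lee_sum => k _; exact: muI.
  by rewrite sumEFin sumr_const card_ord lee_fin mulr_natl.
Qed.

(** The count is made at generation [2n], where columns have width [9^-n]. The set meets at most 3
    intervals of generation [n] and 5 columns of generation [2n], which leaves at most [15 * 3^n]
    intervals of length [81^-n]. *)
Lemma peano_fun_cover (n : nat) E :
  (forall u, E u -> 0 <= u) ->
  (forall u v, E u -> E v -> `|u - v| <= (9 ^+ n)^-1) ->
  (forall u v, E u -> E v -> `|peano_fun u - peano_fun v| <= (9 ^+ n)^-1) ->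
  exists V, [/\ measurable V, E `<=` V & (mu V <= (15 / 27 ^+ n)%:E)%E].
Proof.
move=> E0 Eu Ef; have [->|/set0P[u0 Eu0]] := eqVneq E set0.
  by exists set0; split => //; rewrite measure0 lee_fin divr_ge0 ?exprn_ge0.
pose i0 := Num.truncn (9 ^+ n * u0); pose c0 := peano_column (n + n) u0.
(* If [i0.-1] or [c0 - 2] is truncated at 0, the window only shifts upwards and still contains all
   admissible indices from 0 on. *)
pose s := [seq j <- index_iota (9 ^ n * i0.-1) (9 ^ n * (i0.-1 + 3)) |
  (c0 - 2 <= peano_index (n + n) j < c0 - 2 + 5)%N].
have ps : (size s <= 15 * 3 ^ n)%N.
  rewrite size_filter -sum1_count big_mkcond /=.
  exact: (peano_index_count_window n n i0.-1 3 (c0 - 2) 5).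
have p9 : 0 < 9 ^+ n :> R by rewrite exprn_gt0.
have [V [mV VI muV]] := measure_bigsetU_itv s (9 ^+ (n + n)) (exprn_gt0 _ (ltr0n _ 9)).
exists V; split => //; last first.
  apply: le_trans muV _; rewrite lee_fin.
  have -> : 15 / 27 ^+ n = (15 * 3 ^ n)%:R / 9 ^+ (n + n) :> R.
    have -> : 9 ^+ (n + n) = 3 ^+ n * 27 ^+ n :> R.
      by rewrite exprD -!exprMn; congr (_ ^+ n); ring.
    rewrite natrM natrX; field.
    by rewrite !expf_neq0.
  by rewrite ler_pM2r ?invr_gt0 ?exprn_gt0 // ler_nat.
move=> u Euu; apply: (VI (Num.truncn (9 ^+ (n + n) * u))); last first.
  have := truncn_itv (mulr_ge0 (exprn_ge0 (n + n) (ler0n R 9)) (E0 _ Euu)).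
  by move=> /andP[-> /ltW ->].
have near v w : E v -> E w -> v <= w -> Num.truncn (9 ^+ n * w) = Num.truncn (9 ^+ n * v) \/
    Num.truncn (9 ^+ n * w) = (Num.truncn (9 ^+ n * v)).+1.
  move=> Ev Ew vw; apply: truncn_near; rewrite ?mulr_ge0 ?(ltW p9) ?E0 ?ler_pM2l //.
  rewrite -mulrBr mulrC -ler_pdivlMr // div1r.
  by have := Eu _ _ Ew Ev; rewrite ger0_norm // subr_ge0.
(* One unit comes from the variation of [peano_fun], the other from the position inside a column. *)
have ci v w : E v -> E w -> (peano_column (n + n) v <= peano_column (n + n) w + 2)%N.
  move=> Ev Ew; rewrite -(ler_nat R) natrD.
  have /andP[+ _] := peano_fun_column (n + n) v (E0 _ Ev).
  have /andP[_] := peano_fun_column (n + n) w (E0 _ Ew).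
  have -> : 3 ^+ (n + n) = 9 ^+ n :> R by rewrite exprD -exprMn; congr (_ ^+ n); ring.
  have := Ef _ _ Ev Ew; rewrite ler_norml => /andP[_ h].
  rewrite -(ler_pM2l p9) mulrBr mulfV ?gt_eqF // in h; move: h.
  rewrite -(natr1 (peano_column _ w)).
  move: (_ * peano_fun v) (_ * peano_fun w) (peano_column _ v)%:R (peano_column _ w)%:R.
  by move=> A B a b; lra.
rewrite mem_filter; apply/andP; split.
  have := ci _ _ Euu Eu0; have := ci _ _ Eu0 Euu; rewrite -/c0 {1 2}/peano_column.
  by move: (peano_index _ _) => c; lia.
have ti : (Num.truncn (9 ^+ (n + n) * u) %/ 9 ^ n)%N = Num.truncn (9 ^+ n * u).
  rewrite exprD -mulrA -[X in Num.truncn (X * _)](natrX R 9 n) truncn_divn ?expn_gt0 //.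
  by rewrite mulr_ge0 ?(ltW p9) ?E0.
have i3 : (i0.-1 <= Num.truncn (9 ^+ n * u) < i0.-1 + 3)%N.
  case: (leP u u0) => [uu|/ltW uu].
    by have := near _ _ Euu Eu0 uu; rewrite -/i0; lia.
  by have := near _ _ Eu0 Euu uu; rewrite -/i0; lia.
rewrite mem_index_iota -ti in i3 *.
rewrite leq_divRL ?expn_gt0 // ltn_divLR ?expn_gt0 // in i3.
by rewrite ![(9 ^ n * _)%N]mulnC.
Qed.

Lemma peano_fun_mass E (r : R) : 0 <= r <= 1 ->
  (forall u, E u -> 0 <= u) ->
  (forall u v, E u -> E v -> `|u - v| <= r) ->
  (forall u v, E u -> E v -> `|peano_fun u - peano_fun v| <= r) ->
  exists V, [/\ measurable V, E `<=` V & (mu V <= (405 * r `^ (3 / 2))%:E)%E].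
Proof.
move=> /andP[r0 r1] E0 Eu Ef; move: r0; rewrite le_eqVlt => /predU1P[r0|r0].
  have [->|/set0P[u Euu]] := eqVneq E set0.
    by exists set0; split => //; rewrite measure0 lee_fin mulr_ge0 ?ler0n ?powR_ge0.
  exists [set u]; split => //.
    move=> v Ev; apply/eqP; rewrite -subr_eq0 -normr_le0.
    by have := Eu _ _ Ev Euu; rewrite -r0.
  by rewrite lebesgue_measure_set1 lee_fin mulr_ge0 ?ler0n ?powR_ge0.
have [n /andP[lo hi]] := pow9_scale r (introT andP (conj r0 r1)).
have [V [mV EV muV]] := peano_fun_cover n E E0
  (fun u v Eu' Ev' => le_trans (Eu u v Eu' Ev') hi)
  (fun u v Eu' Ev' => le_trans (Ef u v Eu' Ev') hi).
exists V; split => //; apply: le_trans muV _; rewrite lee_fin.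
(* Replacing [9^-n] by [9^-(n+1)], which is below [r], costs [9^(3/2) = 27], and [405 = 15 * 27]. *)
have -> : 15 / 27 ^+ n = 405 * ((9 ^+ n.+1)^-1) `^ (3 / 2) :> R.
  have -> : (9 ^+ n.+1)^-1 = (3 ^+ n.+1)^-1 `^ 2%:R :> R.
    rewrite powR_mulrn ?invr_ge0 ?exprn_ge0 // exprVn -exprM mulnC exprM.
    by congr (_ ^+ _)^-1; ring.
  rewrite -powRrM; have -> : 2%:R * (3 / 2) = 3%:R :> R by field.
  rewrite powR_mulrn ?invr_ge0 ?exprn_ge0 // exprVn -exprM mulnC exprM.
  have -> : 3 ^+ 3 = 27 :> R by ring.
  by rewrite exprS; field; rewrite expf_neq0.
by rewrite ler_pM2l ?ltr0n // ge0_ler_powR ?nnegrE ?invr_ge0 ?exprn_ge0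
  ?divr_ge0 ?(ltW r0) ?(ltW lo).
Qed.

End PeanoMass.

(** * Bounds on the Hausdorff dimension *)

Section HausdorffDimension.
Context {R : realType} {T : Type} (d : T -> T -> R).
Implicit Types (A U : set T) (s eps r : R).
Local Open Scope ereal_scope.

Lemma diameter_ge0 U : 0 <= diameter d U.
Proof. by rewrite /diameter le_max lexx. Qed.

Lemma le_diameter U x y : U x -> U y -> (d x y)%:E <= diameter d U.
Proof.
move=> Ux Uy; rewrite /diameter le_max; apply/orP; right.
by apply: ereal_sup_ubound; exists x, y.
Qed.

Lemma diameter_le U r : (0 <= r)%R -> (forall x y, U x -> U y -> d x y <= r)%R ->
  diameter d U <= r%:E.
Proof.
move=> r0 Ur; rewrite /diameter ge_max lee_fin r0 /=.
by apply/ereal_supP => _ [x [y [Ux Uy ->]]]; rewrite lee_fin Ur.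
Qed.

Lemma diameter_EFin U eps : diameter d U <= eps%:E ->
  exists r, [/\ (0 <= r)%R, (r <= eps)%R & diameter d U = r%:E].
Proof.
have := diameter_ge0 U; case: (diameter d U) => [r| |] // r0 re.
by exists r; rewrite !lee_fin in r0 re.
Qed.

Lemma diameter_power_ge0 s U : 0 <= diameter_power d s U.
Proof. by rewrite /diameter_power; case: ifP => // _; exact: poweR_ge0. Qed.

(** Powers of a number in [[0, 1]] decrease with the exponent; at diameter 0 this uses [0 < s'], as
    the power with exponent 0 is 1. *)
Lemma diameter_power_antitone s s' U : diameter d U <= 1%:E ->
  (0 <= s)%R -> (s <= s')%R -> (0 < s')%R ->
  diameter_power d s' U <= diameter_power d s U.
Proof.
move=> /diameter_EFin[r [r0 r1 Ur]] s0 ss' s'0.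
rewrite /diameter_power; case: ifP => // _; rewrite Ur !poweR_EFin lee_fin.
move: r0; rewrite le_eqVlt => /predU1P[<-|r0].
  by rewrite powR0 ?gt_eqF // powR_ge0.
by apply: ger_powR; rewrite // r0.
Qed.

Lemma diameter_power_le s U r : (0 <= s)%R -> diameter d U <= r%:E ->
  diameter_power d s U <= (r `^ s)%:E.
Proof.
move=> s0 /diameter_EFin[t [t0 tr Ut]].
rewrite /diameter_power; case: ifP => _; first by rewrite lee_fin powR_ge0.
by rewrite Ut poweR_EFin lee_fin ge0_ler_powR ?nnegrE // (le_trans t0).
Qed.

Lemma hausdorff_premeasure_ge0 s eps A : 0 <= hausdorff_premeasure d s eps A.
Proof.
apply/ereal_infP => _ [U [_ _ ->]]; apply: nneseries_ge0 => k _ _.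
exact: diameter_power_ge0.
Qed.

Lemma hausdorff_premeasure_fincover s eps A (I : finType) (U : I -> set T) r :
  (0 <= s)%R -> (0 <= r <= eps)%R ->
  A `<=` \bigcup_i U i -> (forall i, diameter d (U i) <= r%:E) ->
  hausdorff_premeasure d s eps A <= (#|I|%:R * r `^ s)%:E.
Proof.
move=> s0 /andP[r0 re] AU Ur.
(* The finite cover is padded to a sequence by empty sets, whose [diameter_power] is 0. *)
pose V k := if (insub k : option 'I_#|I|) is Some o then U (enum_val o) else set0.
have Vr k : diameter d (V k) <= r%:E.
  rewrite /V; case: insubP => [j _ _ | _]; first exact: Ur.
  by apply: diameter_le.
apply: (@le_trans _ _ (\sum_(0 <= k <oo) diameter_power d s (V k))).
  apply: ereal_inf_lbound; exists V; split => //.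
    move=> x /AU[i _ Ui]; exists (enum_rank i) => //.
    rewrite /V insubT //= => lt; rewrite /V.
    have -> : Sub (enum_rank i : nat) lt = enum_rank i :> 'I_#|I| by exact: val_inj.
    by rewrite enum_rankK.
  by move=> k; apply: le_trans (Vr k) _; rewrite lee_fin.
apply: lime_le; first by apply: is_cvg_nneseries => k _ _; exact: diameter_power_ge0.
exists 0%N => // n _ /=.
apply: (@le_trans _ _ (\sum_(0 <= k < n) (if (k < #|I|)%N then (r `^ s)%:E else 0))).
  apply: lee_sum => k _; case: ifP => kI; first exact: diameter_power_le.
  by rewrite /V insubN ?kI //= /diameter_power eqxx.
(* Either of [n] and [#|I|] may be the larger, so both sums are widened to the range up to
   [n + #|I|]. *)
rewrite -big_mkcond /= (big_nat_widen _ _ (n + #|I|)) ?leq_addr //=.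
apply: (@le_trans _ _ (\sum_(0 <= k < n + #|I| | (k < #|I|)%N) (r `^ s)%:E)).
  rewrite big_mkcond [leRHS]big_mkcond; apply: lee_sum => k _.
  by case: (k < #|I|)%N; case: (k < n)%N => //=; rewrite lee_fin powR_ge0.
rewrite [leLHS](_ : _ = \sum_(0 <= k < #|I|) (r `^ s)%:E); last first.
  by rewrite [RHS](big_nat_widen _ _ (n + #|I|)) ?leq_addl.
by rewrite sumEFin sumr_const_nat subn0 mulr_natl.
Qed.

(* At scale [n^-2], the number [(n^-2)^(-3/2)] of sets is the natural number [n^3]. *)
Lemma hausdorff_dimension_le A (C : nat) (D : R) : (0 <= D)%R ->
  (forall n, (0 < n)%N -> exists (I : finType) (U : I -> set T),
    [/\ (#|I| <= C * n ^ 3)%N, A `<=` \bigcup_i U i &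
        forall i, diameter d (U i) <= (D / n%:R ^+ 2)%:E]) ->
  hausdorff_dimension d A <= (3 / 2)%:E.
Proof.
move=> D0 cover; apply/lee_addgt0Pr => e e0.
apply: ereal_inf_lbound; exists (3 / 2 + e)%R => //.
have s0 : (0 <= 3 / 2 + e :> R)%R by lra.
split=> //; apply/eqP; rewrite eq_le; apply/andP; split; last first.
  apply: (@le_trans _ _ (hausdorff_premeasure d (3 / 2 + e) 1 A)).
    exact: hausdorff_premeasure_ge0.
  by apply: ereal_sup_ubound; exists 1%R; rewrite /= ?ltr01.
rewrite /hausdorff_measure; apply/ereal_supP => _ [eps /= eps0 <-].
(* With exponent [3/2 + e], the [n^3] sets contribute [n^3 * n^(-3 - 2e) = n^(-2e)] up to a
   constant, which tends to 0. *)
have bound n : (0 < n)%N -> (D / n%:R ^+ 2 <= eps)%R ->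
    hausdorff_premeasure d (3 / 2 + e) eps A
      <= (C%:R * D `^ (3 / 2 + e) * (n%:R `^ (2 * e))^-1)%:E.
  move=> n0 De; have [I [U [cI AU Ud]]] := cover n n0.
  have nR : (0 < n%:R :> R)%R by rewrite ltr0n.
  have De0 : (0 <= D / n%:R ^+ 2 <= eps)%R by rewrite De divr_ge0 ?exprn_ge0 ?ler0n.
  apply: le_trans (hausdorff_premeasure_fincover _ _ _ _ _ _ s0 De0 AU Ud) _.
  rewrite lee_fin; apply: (@le_trans _ _ ((C * n ^ 3)%:R * (D / n%:R ^+ 2) `^ (3 / 2 + e))%R).
    by rewrite ler_wpM2r ?powR_ge0 // ler_nat.
  rewrite powRM ?invr_ge0 ?exprn_ge0 ?ler0n // -(powR_mulrn _ (ler0n _ _)) -powRN -powRrM.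
  rewrite natrM natrX -(powR_mulrn _ (ler0n _ _)) -powRN.
  rewrite -!mulrA ler_wpM2l // mulrCA ler_wpM2l ?powR_ge0 //.
  rewrite -powRD; last by rewrite (gt_eqF nR) implybT.
  by rewrite le_eqVlt; apply/orP; left; apply/eqP; congr (_ `^ _)%R; field.
apply/lee_addgt0Pr => t t0; rewrite add0e.
pose K := (C%:R * D `^ (3 / 2 + e))%R.
have K0 : (0 <= K)%R by rewrite mulr_ge0 ?ler0n ?powR_ge0.
(* The second entry makes the diameters at most [eps], the third makes [K * n^(-2e)] at most [t]. *)
pose n := (maxn 1 (maxn (Num.truncn (D / eps)).+1 (Num.truncn ((K / t) `^ (2 * e)^-1)).+1))%N.
have n1 : (0 < n)%N by rewrite /n leq_max.
have nR : (1 <= n%:R :> R)%R by rewrite ler1n.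
have n2 : (D / eps <= n%:R)%R.
  by rewrite (le_trans (ltW (truncnS_gt _))) // ler_nat /n !leq_max leqnn ?orbT.
have n3 : ((K / t) `^ (2 * e)^-1 <= n%:R)%R.
  by rewrite (le_trans (ltW (truncnS_gt _))) // ler_nat /n !leq_max leqnn ?orbT.
apply: le_trans (bound n n1 _) _.
  rewrite ler_pdivrMr ?exprn_gt0 ?ltr0n // mulrC -ler_pdivrMr //.
  by rewrite (le_trans n2) // expr2 ler_peMr // ler0n.
rewrite lee_fin -/K ler_pdivrMr ?powR_gt0 ?ltr0n // mulrC -ler_pdivrMr //.
have {n3} := ge0_ler_powR (r := (2 * e)%R) _ _ _ n3.
rewrite -powRrM mulVf ?powRr1; last by lra.
  by apply; rewrite ?nnegrE ?powR_ge0 ?ler0n //; lra.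
by rewrite divr_ge0 // ltW.
Qed.

(* The mass distribution principle for the image of Lebesgue measure on [0, 1]. *)
Lemma hausdorff_dimension_ge A (g : R -> T) s0 eps C :
  (0 < s0)%R -> (0 < eps <= 1)%R -> (0 < C)%R ->
  (forall u, (0 <= u <= 1)%R -> A (g u)) ->
  (forall U, diameter d U <= eps%:E -> exists V : set R,
    [/\ measurable V, (forall u, (0 <= u <= 1)%R -> U (g u) -> V u) &
        lebesgue_measure V <= C%:E * diameter_power d s0 U]) ->
  s0%:E <= hausdorff_dimension d A.
Proof.
move=> s00 /andP[eps0 eps1] C0 gA gU.
apply/ereal_infP => _ [s [s_ge0 H0] <-]; rewrite lee_fin leNgt; apply/negP => ss0.
(* A null measure for some [s < s0] gives a cover whose sum is below [1 / C]; the sets [V k] then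
   cover [[0, 1]] with total measure below 1. *)
have : hausdorff_premeasure d s eps A < (C^-1)%:E.
  apply: (@le_lt_trans _ _ 0); last by rewrite lte_fin invr_gt0.
  by rewrite -H0; apply: ereal_sup_ubound; exists eps.
move=> /ereal_inf_lt[_ [U [AU Ueps ->]] Usum].
have /choice[V HV] k : exists V : set R,
    [/\ measurable V, (forall u, (0 <= u <= 1)%R -> U k (g u) -> V u) &
        lebesgue_measure V <= C%:E * diameter_power d s (U k)].
  have [V [mV UV muV]] := gU _ (Ueps k); exists V; split => //.
  apply: le_trans muV _; rewrite lee_pmul2l // ?lte_fin //.
  apply: diameter_power_antitone => //; last exact: ltW.
  by rewrite (le_trans (Ueps k)) // lee_fin.
have : lebesgue_measure (`[0%R, 1%R]%classic : set R) <=
    \sum_(0 <= k <oo) lebesgue_measure (V k).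
  apply: measure_sigma_subadditive => //.
  - by move=> k; case: (HV k).
  - move=> u /=; rewrite in_itv /= => u01; have [k _ Uk] := AU _ (gA u u01).
    by exists k => //; case: (HV k) => _ + _; exact.
rewrite lebesgue_measure_itv /= lte_fin ltr01 sube0 leNgt => /negP; apply.
apply: (@le_lt_trans _ _ (\sum_(0 <= k <oo) (C%:E * diameter_power d s (U k)))).
  by apply: lee_nneseries => [k _ _|k _]; [exact: measure_ge0|case: (HV k)].
rewrite nneseriesZl; last by move=> k _; exact: diameter_power_ge0.
apply: (@lt_le_trans _ _ (C%:E * (C^-1)%:E)); first by rewrite lte_pmul2l // lte_fin.
by rewrite -EFinM mulfV ?gt_eqF.
Qed.

End HausdorffDimension.

(** * The homogeneous distance *)

Section RoughNorm.
Context {R : realType}.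
Implicit Types (p q : R * R) (x y u v m : R).

Definition sup_norm p : R := Num.max `|p.1| `|p.2|.

Lemma sup_norm_ge0 p : 0 <= sup_norm p.
Proof. by rewrite /sup_norm le_max normr_ge0. Qed.

Lemma sup_normP p m : (sup_norm p <= m) = (`|p.1| <= m) && (`|p.2| <= m).
Proof. by rewrite /sup_norm ge_max. Qed.

Lemma sup_norm1 p : `|p.1| <= sup_norm p.
Proof. by rewrite /sup_norm le_max lexx. Qed.

Lemma sup_norm2 p : `|p.2| <= sup_norm p.
Proof. by rewrite /sup_norm le_max lexx orbT. Qed.

Lemma sup_normD p q : sup_norm (p + q) <= sup_norm p + sup_norm q.
Proof.
rewrite sup_normP !(le_trans (ler_normD _ _)) // lerD ?sup_norm1 ?sup_norm2 //.
Qed.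

Lemma sup_normN p : sup_norm (- p) = sup_norm p.
Proof. by rewrite /sup_norm !normrN. Qed.

Lemma sup_norm_eq0 p : sup_norm p = 0 -> p = 0.
Proof.
case: p => x y p0; have := sup_norm1 (x, y); have := sup_norm2 (x, y).
by rewrite p0 /= !normr_le0 => /eqP -> /eqP ->.
Qed.

Lemma sup_normZ x p : 0 <= x -> sup_norm (x * p.1, x * p.2) = x * sup_norm p.
Proof. by move=> x0; rewrite /sup_norm /= !normrM (ger0_norm x0) maxr_pMr. Qed.

Lemma sqrtrB_le x y : 0 <= y <= x -> Num.sqrt x - Num.sqrt y <= Num.sqrt (x - y).
Proof.
move=> /andP[y0 yx]; have x0 := le_trans y0 yx.
rewrite lerBlDr -(@ler_pXn2r _ 2) ?nnegrE ?addr_ge0 ?sqrtr_ge0 //.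
rewrite sqrrD !sqr_sqrtr ?subr_ge0 // addrAC subrK lerDl.
by rewrite mulrn_wge0 // mulr_ge0 ?sqrtr_ge0.
Qed.

(* The 1/2-homogeneous extension of [peano_fun] to the cone [0 <= v <= x]; it is
   0 at the apex since [sqrt 0 = 0]. *)
Definition cone_fun x v : R := Num.sqrt x * peano_fun (v / x).

Lemma cone_fun_itv x v : 0 <= v <= x -> 0 <= cone_fun x v <= Num.sqrt x.
Proof.
move=> /andP[v0 vx]; have /andP[f0 f1] := peano_fun_itv (v / x) (divr_ge0 v0 (le_trans v0 vx)).
by rewrite mulr_ge0 ?sqrtr_ge0 //= ler_piMr ?sqrtr_ge0.
Qed.

Lemma cone_fun_holder x v y u m : 0 <= v <= x -> 0 <= u <= y ->
  `|x - y| <= m -> `|v - u| <= m ->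
  `|cone_fun x v - cone_fun y u| <= 10 * Num.sqrt m.
Proof.
wlog yx : x v y u / y <= x => [H vx uy dxy dvu|].
  case: (leP y x) => [|/ltW] xy; first exact: H.
  by rewrite distrC H // distrC.
move=> /andP[v0 vx] /andP[u0 uy] dxy dvu.
have y0 := le_trans u0 uy; have x0 := le_trans y0 yx.
have m0 := le_trans (normr_ge0 _) dxy.
have /andP[fv0 fv1] := peano_fun_itv (v / x) (divr_ge0 v0 x0).
have sxy : Num.sqrt x - Num.sqrt y <= Num.sqrt m.
  apply: le_trans (sqrtrB_le _ _ _) _; first by rewrite y0.
  by rewrite ler_sqrt // (le_trans (ler_norm _)).
have sxy0 : 0 <= Num.sqrt x - Num.sqrt y by rewrite subr_ge0 ler_sqrt.
have second : Num.sqrt y * `|peano_fun (v / x) - peano_fun (u / y)| <= 9 * Num.sqrt m.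
  apply: (@le_trans _ _ (Num.sqrt y * (6 * Num.sqrt `|v / x - u / y|))).
    by rewrite ler_wpM2l ?sqrtr_ge0 // peano_fun_holder // divr_ge0.
  rewrite mulrCA -sqrtrM //.
  (* It remains to bound [y * |v / x - u / y|] by [2 * m], and 2 is at most [(3 / 2)^2]. Together
     with [sxy] this gives the constant [1 + 9 = 10]. *)
  have -> : 9 * Num.sqrt m = 6 * Num.sqrt ((3 / 2) ^+ 2 * m).
    by rewrite sqrtrM ?sqr_ge0 // sqrtr_sqr ger0_norm //; lra.
  rewrite ler_pM2l // ler_sqrt; last by rewrite mulr_ge0 ?sqr_ge0.
  apply: (@le_trans _ _ (m + m)); last by lra.
  have [->|yn0] := eqVneq y 0; first by rewrite mul0r addr_ge0.
  have yp : 0 < y by rewrite lt_def yn0.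
  have xp : 0 < x by exact: lt_le_trans yp yx.
  rewrite -{1}(ger0_norm y0) -normrM.
  have -> : y * (v / x - u / y) = (v - u) - (v / x) * (x - y).
    by field; rewrite !gt_eqF.
  apply: le_trans (ler_normB _ _) _; rewrite lerD //.
  rewrite normrM (le_trans _ dxy) // ler_piMl // ger0_norm ?divr_ge0 //.
  by rewrite ler_pdivrMr // mul1r.
rewrite /cone_fun.
have -> : Num.sqrt x * peano_fun (v / x) - Num.sqrt y * peano_fun (u / y) =
    (Num.sqrt x - Num.sqrt y) * peano_fun (v / x) +
    Num.sqrt y * (peano_fun (v / x) - peano_fun (u / y)) by ring.
apply: le_trans (ler_normD _ _) _; rewrite !normrM (ger0_norm sxy0) (ger0_norm fv0).
rewrite (ger0_norm (sqrtr_ge0 y)).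
have : (Num.sqrt x - Num.sqrt y) * peano_fun (v / x) <= Num.sqrt m.
  by apply: le_trans sxy; rewrite ler_piMr.
move: second; move: (_ * `|_|) (_ * peano_fun _) => A B; lra.
Qed.

Definition ripple p : R := cone_fun `|p.1| (Num.min `|p.1| `|p.2|).

Lemma ripple_cone p : 0 <= Num.min `|p.1| `|p.2| <= `|p.1|.
Proof. by rewrite le_min !normr_ge0 ge_min lexx. Qed.

Lemma ripple_itv p : 0 <= ripple p <= Num.sqrt (sup_norm p).
Proof.
have /andP[-> /le_trans ->] := cone_fun_itv _ _ (ripple_cone p) => //.
by rewrite ler_sqrt ?sup_norm_ge0 // sup_norm1.
Qed.

(** Both arguments passed to [cone_fun] are 1-Lipschitz for the sup norm. *)
Lemma ripple_holder p q : `|ripple p - ripple q| <= 10 * Num.sqrt (sup_norm (p - q)).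
Proof.
have d1 := sup_norm1 (p - q); have d2 := sup_norm2 (p - q).
have e1 := le_trans (lerB_dist p.1 q.1) d1; have e2 := le_trans (lerB_dist p.2 q.2) d2.
rewrite -normrN opprB in d1; rewrite -normrN opprB in d2.
have f1 := le_trans (lerB_dist q.1 p.1) d1; have f2 := le_trans (lerB_dist q.2 p.2) d2.
apply: cone_fun_holder (ripple_cone p) (ripple_cone q) _ _.
  by rewrite ler_norml; lra.
rewrite ler_norml; apply/andP; split.
  by case: (leP `|p.1|) => ?; case: (leP `|q.1|) => ?; lra.
by case: (leP `|p.1|) => ?; case: (leP `|q.1|) => ?; lra.
Qed.

(** The factor 1/20 turns the Hölder constant 10 of [ripple] into 1/2, the slack available in the
    square root. *)
Definition rough_norm p : R := Num.sqrt (sup_norm p) + ripple p / 20.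

Lemma rough_norm_itv p :
  Num.sqrt (sup_norm p) <= rough_norm p <= 2 * Num.sqrt (sup_norm p).
Proof. by rewrite /rough_norm; have /andP[] := ripple_itv p; lra. Qed.

Lemma rough_normN p : rough_norm (- p) = rough_norm p.
Proof. by rewrite /rough_norm /ripple sup_normN /= !normrN. Qed.

Lemma rough_norm0P p : rough_norm p = 0 <-> p = 0.
Proof.
split=> [p0|->].
  apply: sup_norm_eq0; apply/eqP; rewrite eq_le sup_norm_ge0 andbT -sqrtr_eq0.
  by have /andP[+ _] := rough_norm_itv p; rewrite p0 => h; rewrite eq_le h sqrtr_ge0.
rewrite /rough_norm /ripple /cone_fun /sup_norm /= normr0 maxxx sqrtr0.
by rewrite !mul0r addr0.
Qed.

Lemma rough_normZ x p : 0 < x -> rough_norm (square_dilation x p) = x * rough_norm p.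
Proof.
move=> x0; have x20 : 0 <= x ^+ 2 by rewrite sqr_ge0.
have sx : Num.sqrt (x ^+ 2) = x by rewrite sqrtr_sqr gtr0_norm.
rewrite /rough_norm sup_normZ // sqrtrM // sx mulrDr mulrA; congr (_ + _ / _).
rewrite /ripple /cone_fun /square_dilation /= !(normrM (x ^+ 2)) (ger0_norm x20) -minr_pMr //.
rewrite sqrtrM // sx -mulrA -mulf_div divff ?mul1r //.
by rewrite expf_neq0 // gt_eqF.
Qed.

(* The square root is so strictly subadditive that it absorbs a small
   1/2-Hölder perturbation. *)
Lemma rough_normD p q : rough_norm (p + q) <= rough_norm p + rough_norm q.
Proof.
wlog qp : p q / sup_norm q <= sup_norm p => [H|].
  case: (leP (sup_norm q) (sup_norm p)) => [|/ltW] h; first exact: H.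
  by rewrite addrC [leRHS]addrC H.
have root : Num.sqrt (sup_norm (p + q)) <=
    Num.sqrt (sup_norm p) + Num.sqrt (sup_norm q) / 2.
  apply: le_trans (_ : Num.sqrt (sup_norm p + sup_norm q) <= _).
    by rewrite ler_sqrt ?addr_ge0 ?sup_norm_ge0 // sup_normD.
  have a0 := sqrtr_ge0 (sup_norm p); have b0 := sqrtr_ge0 (sup_norm q).
  rewrite -(@ler_pXn2r _ 2) ?nnegrE ?addr_ge0 ?divr_ge0 ?sqrtr_ge0 //.
  rewrite sqr_sqrtr ?addr_ge0 ?sup_norm_ge0 //.
  rewrite -{1}(sqr_sqrtr (sup_norm_ge0 p)) -{1}(sqr_sqrtr (sup_norm_ge0 q)).
  have : Num.sqrt (sup_norm q) <= Num.sqrt (sup_norm p).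
    by rewrite ler_sqrt ?sup_norm_ge0.
  by move: a0 b0; move: (Num.sqrt _) (Num.sqrt _) => a b *; nra.
(* Passing from [p] to [p + q] raises [ripple / 20] by at most half of [Num.sqrt (sup_norm q)], the
   half that [root] leaves over; [ripple q] is nonnegative. *)
have := ripple_holder (p + q) p; rewrite addrAC subrr add0r ler_norml => /andP[_].
have /andP[+ _] := ripple_itv q; rewrite /rough_norm.
move: root; move: (Num.sqrt _) (Num.sqrt _) (Num.sqrt _) => a b c; lra.
Qed.

Lemma rough_norm_dist p q : `|rough_norm p - rough_norm q| <= rough_norm (p - q).
Proof.
rewrite ler_norml lerBlDr [X in _ && X](_ : _ = true); last first.
  by rewrite -{1}(subrK q p) rough_normD.
rewrite andbT lerNl opprB lerBlDr -(rough_normN (p - q)) opprB.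
by rewrite -{1}(subrK p q) rough_normD.
Qed.

Definition rough_distance p q : R := rough_norm (q - p).

Lemma rough_distance_homogeneous :
  homogeneous_distance square_dilation rough_distance.
Proof.
rewrite /rough_distance; split; first split.
- move=> p q; apply: le_trans (sqrtr_ge0 _) _.
  by case/andP: (rough_norm_itv (q - p)) => h _; exact: h.
- move=> p q; rewrite rough_norm0P; split=> [/eqP|->]; last by rewrite subrr.
  by rewrite subr_eq0 => /eqP.
- by move=> p q; rewrite -rough_normN opprB.
- move=> p q r; rewrite [leRHS]addrC.
  have -> : r - p = (r - q) + (q - p) by rewrite addrA subrK.
  exact: rough_normD.
- by move=> g p q; rewrite opprD addrACA subrr add0r.
- move=> l p q l0; rewrite -rough_normZ //; congr rough_norm.
  by rewrite /square_dilation /=; congr pair; rewrite /= mulrBr.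
Qed.

Lemma rough_sphereE p : unit_sphere rough_distance p = (rough_norm p = 1).
Proof. by rewrite /unit_sphere /rough_distance /= subr0. Qed.

End RoughNorm.

(** * Dimension of the unit sphere *)

Section RoughSphere.
Context {R : realType}.
Implicit Types (p q : R * R) (s t u : R).
Local Notation sphere := (unit_sphere (@rough_distance R)).

Lemma euclidean_distance_le p q (a b : R) : `|p.1 - q.1| <= a -> `|p.2 - q.2| <= b ->
  euclidean_distance p q <= a + b.
Proof.
move=> pa qb; have a0 := le_trans (normr_ge0 _) pa; have b0 := le_trans (normr_ge0 _) qb.
rewrite -(ger0_norm (addr_ge0 a0 b0)) -sqrtr_sqr ler_sqrt ?sqr_ge0 //.
have sq (x c : R) : `|x| <= c -> x ^+ 2 <= c ^+ 2.
  by move=> xc; rewrite -(real_normK (num_real x)) ler_pXn2r ?nnegrE // (le_trans _ xc).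
by have := sq _ _ pa; have := sq _ _ qb; have := mulr_ge0 a0 b0; nra.
Qed.

Lemma euclidean_distance_ge p q :
  `|p.1 - q.1| <= euclidean_distance p q /\ `|p.2 - q.2| <= euclidean_distance p q.
Proof.
by rewrite /euclidean_distance; split; rewrite -sqrtr_sqr ler_sqrt ?addr_ge0 ?sqr_ge0 //
  ?lerDl ?lerDr sqr_ge0.
Qed.

Lemma truncn_eq_near (x y : R) : 0 <= x -> 0 <= y -> Num.truncn x = Num.truncn y ->
  `|x - y| <= 1.
Proof.
move=> x0 y0 xy; have /andP[x1 x2] := truncn_itv x0; have /andP[y1 y2] := truncn_itv y0.
move: x1 x2 y1 y2; rewrite xy -(natr1 (Num.truncn y)) ler_norml.
by move: (_%:R) => k; lra.
Qed.

(* [b.1] tells which coordinate is constant on the side, [b.2] gives its sign. *)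
Definition square_side (b : bool * bool) s : R * R :=
  let c := if b.2 then 1 else -1 in if b.1 then (c, s) else (s, c).

Lemma sup_norm_side b s : `|s| <= 1 -> sup_norm (square_side b s) = 1.
Proof.
move=> s1; rewrite /square_side /sup_norm.
have c1 : `|(if b.2 then 1 else -1) : R| = 1 by case: b.2; rewrite ?normrN normr1.
by case: b.1 => /=; rewrite c1; [rewrite max_l|rewrite max_r].
Qed.

Lemma sup_norm_sideB b s t : sup_norm (square_side b s - square_side b t) = `|s - t|.
Proof.
by rewrite /square_side /sup_norm; case: b.1 => /=; rewrite subrr normr0;
  [rewrite max_r|rewrite max_l].
Qed.

Lemma sup_norm_polar p : exists b s, `|s| <= 1 /\
  p = (sup_norm p * (square_side b s).1, sup_norm p * (square_side b s).2).
Proof.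
have [p0|pn0] := eqVneq (sup_norm p) 0.
  exists (true, true), 0; rewrite normr0 ler01 p0 !mul0r; split => //.
  by rewrite (sup_norm_eq0 p p0).
have pp : 0 < sup_norm p by rewrite lt_def pn0 sup_norm_ge0.
have side (x : R) : `|x| = sup_norm p -> x = sup_norm p * (if 0 <= x then 1 else -1).
  by case: leP => x0 <-; [rewrite ger0_norm // mulr1|rewrite ltr0_norm // mulrN1 opprK].
have small (x : R) : `|x| <= sup_norm p -> `|x / sup_norm p| <= 1.
  by move=> xp; rewrite normrM normfV (gtr0_norm pp) ler_pdivrMr // mul1r.
case: p pn0 pp side small => x y pn0 pp side small.
case: (leP `|y| `|x|) => xy.
  exists (true, 0 <= x), (y / sup_norm (x, y)); split.
    by apply: small; exact: (sup_norm2 (x, y)).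
  rewrite /square_side /= mulrCA divff // mulr1 -side //.
  by rewrite /sup_norm /= max_l.
exists (false, 0 <= y), (x / sup_norm (x, y)); split.
  by apply: small; exact: (sup_norm1 (x, y)).
rewrite /square_side /= mulrCA divff // mulr1 -side //.
by rewrite /sup_norm /= max_r // ltW.
Qed.

(** * Upper bound: covering the sphere by small cells *)

Lemma rough_norm_side_ge1 b s : `|s| <= 1 -> 1 <= rough_norm (square_side b s).
Proof.
move=> s1; have /andP[+ _] := rough_norm_itv (square_side b s).
by rewrite sup_norm_side // sqrtr1.
Qed.

(** The inverse of [rough_norm] is the dilation parameter that brings a point of the square to the
    sphere. It inherits the 1/2-Hölder bound of [rough_norm], whose values here are at least 1. *)
Lemma rough_norm_side_inv b s t (e : R) :
  `|s| <= 1 -> `|t| <= 1 -> 0 <= e -> `|s - t| <= e ^+ 2 ->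
  `|(rough_norm (square_side b s))^-1 - (rough_norm (square_side b t))^-1| <= 2 * e.
Proof.
move=> s1 t1 e0 ste.
have := rough_norm_dist (square_side b t) (square_side b s).
have /andP[_ +] := rough_norm_itv (square_side b t - square_side b s).
rewrite sup_norm_sideB distrC => h1 h2.
have {h1 h2} := le_trans h2 h1.
have se : Num.sqrt `|s - t| <= e.
  by rewrite -(ger0_norm e0) -(sqrtr_sqr e) ler_sqrt ?sqr_ge0.
have := rough_norm_side_ge1 b s s1; have := rough_norm_side_ge1 b t t1.
move: (rough_norm (square_side b t)) (rough_norm (square_side b s)) => a c a1 c1 ca.
have a0 : 0 < a by lra.
have c0 : 0 < c by lra.
have -> : c^-1 - a^-1 = (a - c) / (a * c) by field; rewrite !gt_eqF.
rewrite normrM normfV (gtr0_norm (mulr_gt0 a0 c0)) ler_pdivrMr ?mulr_gt0 //.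
apply: (@le_trans _ _ (2 * e)); first by lra.
by rewrite ler_peMr ?mulr_ge0 // mulr_ege1.
Qed.

(** Here [s] is the position on the side and [t] the dilation parameter, both located on grids of
    step [n^-2]. The origin [a] of the second grid is the parameter at the grid point [i], lowered
    by the Hölder bound [2 / n]; [a <= t] is imposed since [Num.truncn] sends all negative numbers
    to 0. *)
Definition sphere_cell (n : nat) (b : bool * bool) (i j : nat) : set (R * R) :=
  let a := (rough_norm (square_side b (i%:R / n%:R ^+ 2 - 1)))^-1 - 2 / n%:R in
  [set p | exists s t, [/\ `|s| <= 1, 0 <= t <= 1,
     p = (t ^+ 2 * (square_side b s).1, t ^+ 2 * (square_side b s).2),
     Num.truncn ((s + 1) * n%:R ^+ 2) = i &
     a <= t /\ Num.truncn ((t - a) * n%:R ^+ 2) = j]].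

(** In a cell [t ^+ 2] varies by at most [2 * n^-2] and [t ^+ 2 * s] by at most [3 * n^-2], whence
    the 5. *)
Lemma sphere_cell_diameter n b i j : (0 < n)%N ->
  (diameter euclidean_distance (sphere_cell n b i j) <= (5 / n%:R ^+ 2)%:E)%E.
Proof.
move=> n0; have nR : 0 < n%:R ^+ 2 :> R by rewrite exprn_gt0 // ltr0n.
apply: diameter_le => [|p q]; first by rewrite divr_ge0 ?ltW.
rewrite /sphere_cell /=; move: (_ - 2 / _) => a.
move=> [s [t [s1 /andP[t0 t1] -> is_ [at_ jt]]]].
move=> [s' [t' [s1' /andP[t0' t1'] -> is' [at' jt']]]].
have near (x y : R) : 0 <= x -> 0 <= y ->
    Num.truncn (x * n%:R ^+ 2) = Num.truncn (y * n%:R ^+ 2) -> `|x - y| <= (n%:R ^+ 2)^-1.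
  move=> x0 y0 /truncn_eq_near; rewrite !mulr_ge0 ?(ltW nR) // => /(_ isT isT).
  by rewrite -mulrBl normrM (gtr0_norm nR) -ler_pdivlMr // div1r.
have sn1 (x : R) : `|x| <= 1 -> 0 <= x + 1 by rewrite ler_norml => /andP[? _]; lra.
have ds : `|s - s'| <= (n%:R ^+ 2)^-1.
  have := near _ _ (sn1 _ s1) (sn1 _ s1') (etrans is_ (esym is')).
  by rewrite opprD addrACA subrr addr0.
have dt : `|t - t'| <= (n%:R ^+ 2)^-1.
  have := near (t - a) (t' - a); rewrite !subr_ge0 => /(_ at_ at' (etrans jt (esym jt'))).
  by rewrite opprB addrA subrK.
have dt2 : `|t ^+ 2 - t' ^+ 2| <= 2 * (n%:R ^+ 2)^-1.
  rewrite subr_sqr normrM mulrC ler_pM //.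
  by rewrite ger0_norm ?addr_ge0 //; lra.
have dts : `|t ^+ 2 * s - t' ^+ 2 * s'| <= 3 * (n%:R ^+ 2)^-1.
  have -> : t ^+ 2 * s - t' ^+ 2 * s' = (t ^+ 2 - t' ^+ 2) * s + t' ^+ 2 * (s - s') by ring.
  apply: le_trans (ler_normD _ _) _.
  have h1 : `|(t ^+ 2 - t' ^+ 2) * s| <= 2 * (n%:R ^+ 2)^-1.
    by apply: le_trans dt2; rewrite normrM ler_piMr.
  have h2 : `|t' ^+ 2 * (s - s')| <= (n%:R ^+ 2)^-1.
    apply: le_trans ds; rewrite normrM ler_piMl // ger0_norm ?sqr_ge0 //.
    by rewrite expr_le1.
  by move: h1 h2; move: `|_| `|_| => A B; lra.
have dtc : `|t ^+ 2 * (if b.2 then 1 else -1) - t' ^+ 2 * (if b.2 then 1 else -1)|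
    <= 2 * (n%:R ^+ 2)^-1.
  by rewrite -mulrBl normrM; case: b.2; rewrite ?normrN normr1 mulr1.
rewrite /square_side; case: b.1 => /=.
  by rewrite [leRHS](_ : _ = 2 / n%:R ^+ 2 + 3 / n%:R ^+ 2); [exact: euclidean_distance_le|ring].
by rewrite [leRHS](_ : _ = 3 / n%:R ^+ 2 + 2 / n%:R ^+ 2); [exact: euclidean_distance_le|ring].
Qed.

Lemma sphere_cell_cover n p : (0 < n)%N -> sphere p ->
  exists b i j, [/\ (i < 2 * n ^ 2 + 1)%N, (j < 4 * n + 1)%N & sphere_cell n b i j p].
Proof.
move=> n0; rewrite rough_sphereE => Np.
have nR : 0 < n%:R :> R by rewrite ltr0n.
have n2R : 0 < n%:R ^+ 2 :> R by rewrite exprn_gt0.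
have [b [s [s1 pE]]] := sup_norm_polar p.
pose t := Num.sqrt (sup_norm p).
have t0 : 0 <= t by exact: sqrtr_ge0.
have t2 : t ^+ 2 = sup_norm p by rewrite sqr_sqrtr // sup_norm_ge0.
have t1 : t <= 1.
  by have /andP[h _] := rough_norm_itv p; rewrite Np in h.
have tp : 0 < t.
  rewrite lt_def t0 andbT; apply/eqP => tz; have /andP[_] := rough_norm_itv p.
  by rewrite Np -/t tz mulr0 ler10.
(* By homogeneity [1 = rough_norm p = t * rough_norm (square_side b s)]. *)
have tE : t = (rough_norm (square_side b s))^-1.
  apply: (mulIf (x := rough_norm (square_side b s))).
    by rewrite gt_eqF // (lt_le_trans ltr01) // rough_norm_side_ge1.
  rewrite mulVf; last by rewrite gt_eqF // (lt_le_trans ltr01) // rough_norm_side_ge1.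
  by rewrite -rough_normZ // /square_dilation t2 -pE.
pose i := Num.truncn ((s + 1) * n%:R ^+ 2).
have /andP[sm1 sp1] : -1 <= s <= 1 by rewrite -ler_norml.
have si0 : 0 <= (s + 1) * n%:R ^+ 2 by rewrite mulr_ge0 ?(ltW n2R) //; lra.
have /andP[i1 i2] := truncn_itv si0; rewrite -/i in i1 i2.
rewrite -ler_pdivrMr // in i1; rewrite -(natr1 i) -ltr_pdivlMr // mulrDl div1r in i2.
have i0 : 0 <= i%:R / n%:R ^+ 2 :> R by rewrite divr_ge0 ?ler0n ?(ltW n2R).
pose si := i%:R / n%:R ^+ 2 - 1 : R.
have si1 : `|si| <= 1 by rewrite /si ler_norml; lra.
have dsi : `|s - si| <= (n%:R^-1) ^+ 2.
  by rewrite exprVn /si ler_norml; move: i1 i2 i0; move: (n%:R ^- 2) => B; lra.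
have nV0 : 0 <= n%:R^-1 :> R by rewrite invr_ge0 ltW.
have := rough_norm_side_inv b s si n%:R^-1 s1 si1 nV0 dsi.
rewrite -tE; pose a := (rough_norm (square_side b si))^-1 - 2 / n%:R => dt.
have /andP[a1 a2] : 0 <= t - a <= 4 / n%:R.
  by move: dt; rewrite /a ler_norml; move: (rough_norm _)^-1 (n%:R^-1) => A B; lra.
exists b, i, (Num.truncn ((t - a) * n%:R ^+ 2)); split.
- rewrite addn1 ltnS /i truncn_le_nat -natr1 natrM natrX.
  by apply: (@le_lt_trans _ _ (2 * n%:R ^+ 2)); [rewrite ler_pM2r //; lra|rewrite ltrDl].
- rewrite addn1 ltnS truncn_le_nat -natr1 natrM.
  apply: (@le_lt_trans _ _ (4 * n%:R)); last by rewrite ltrDl.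
  have -> : 4 * n%:R = 4 / n%:R * n%:R ^+ 2 :> R by field; rewrite gt_eqF.
  by rewrite ler_pM2r.
- rewrite /sphere_cell /=; exists s, t; split => //.
  + by rewrite t0.
  + by rewrite t2.
  + by split => //; rewrite -subr_ge0.
Qed.

Lemma rough_sphere_dimension_le :
  (hausdorff_dimension euclidean_distance sphere <= (3 / 2)%:E)%E.
Proof.
(* The number of cells is [4 * (2n^2 + 1) * (4n + 1)], at most [4 * 3n^2 * 5n]. *)
apply: (@hausdorff_dimension_le _ _ _ _ 60 5) => // n n0.
pose J : finType := ((bool * bool) * ('I_(2 * n ^ 2 + 1) * 'I_(4 * n + 1)))%type.
exists J, (fun k : J => sphere_cell n k.1 k.2.1 k.2.2); split.
- by rewrite !card_prod !card_bool !card_ord; nia.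
- move=> p /(sphere_cell_cover n p n0)[b [i [j [li lj pij]]]].
  by exists (b, (Ordinal li, Ordinal lj)).
- by move=> k; exact: sphere_cell_diameter.
Qed.

(** * Lower bound: the copy of the graph of [peano_fun] on the sphere *)

Definition sphere_scale u : R := (1 + peano_fun u / 20)^-1.

(** For [u] in [[0, 1]] this is where the ray through [(1, u)] meets the sphere, as
    [rough_norm (1, u) = 1 + peano_fun u / 20]. *)
Definition sphere_curve u : R * R := (sphere_scale u ^+ 2, sphere_scale u ^+ 2 * u).

Lemma sphere_scale_itv u : 0 <= u -> 20 / 21 <= sphere_scale u <= 1.
Proof.
move=> /peano_fun_itv/andP[f0 f1]; have f20 : 0 < 1 + peano_fun u / 20 by lra.
rewrite /sphere_scale; apply/andP; split.
  by rewrite -(invf_div 21 20) lef_pV2 ?posrE //; lra.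
by rewrite invf_le1 //; lra.
Qed.

Lemma sphere_curve_in u : 0 <= u <= 1 -> sphere (sphere_curve u).
Proof.
move=> /andP[u0 u1]; rewrite rough_sphereE.
have /andP[c0 c1] := sphere_scale_itv u u0; have cp : 0 < sphere_scale u by lra.
have -> : sphere_curve u = square_dilation (sphere_scale u) (1, u).
  by rewrite /square_dilation /= mulr1.
rewrite rough_normZ // /rough_norm /ripple /cone_fun /sup_norm /=.
rewrite normr1 (ger0_norm u0) max_l // min_r // sqrtr1 divr1 mul1r.
by rewrite mulVf // gt_eqF // -invr_gt0.
Qed.

(** The first coordinate determines the scale, hence [peano_fun u], and the quotient of the
    coordinates is [u]; both recoveries are Lipschitz because the scale stays in [[20/21, 1]]. *)
Lemma sphere_curve_expanding u v (r : R) : 0 <= u <= 1 -> 0 <= v <= 1 ->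
  euclidean_distance (sphere_curve u) (sphere_curve v) <= r ->
  `|u - v| <= 40 * r /\ `|peano_fun u - peano_fun v| <= 40 * r.
Proof.
move=> /andP[u0 u1] /andP[v0 v1] uvr.
have [] := euclidean_distance_ge (sphere_curve u) (sphere_curve v).
move=> /le_trans/(_ uvr) + /le_trans/(_ uvr) => /=.
have /andP[a0 a1] := sphere_scale_itv u u0; have /andP[b0 b1] := sphere_scale_itv v v0.
have fE (w : R) : 0 <= w -> peano_fun w = 20 * ((sphere_scale w)^-1 - 1).
  by move=> w0; rewrite /sphere_scale invrK; field.
rewrite (fE u u0) (fE v v0).
move: (sphere_scale u) (sphere_scale v) a0 a1 b0 b1 => a b a0 a1 b0 b1.
have ap : 0 < a by lra.
have bp : 0 < b by lra.
have r_ge (x : R) : `|x| <= r -> 0 <= r by move/(le_trans (normr_ge0 _)).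
move=> h1 h2; have r0 := r_ge _ h1.
have ab : `|a - b| <= r.
  by rewrite subr_sqr normrM in h1; apply: le_trans h1; rewrite ler_peMr // ger0_norm; lra.
split.
  have h : `|a ^+ 2 * (u - v)| <= 2 * r.
    have -> : a ^+ 2 * (u - v) = (a ^+ 2 * u - b ^+ 2 * v) - (a ^+ 2 - b ^+ 2) * v by ring.
    apply: le_trans (ler_normB _ _) _; rewrite [leRHS](_ : _ = r + r); last by ring.
    by rewrite lerD // (le_trans _ h1) // normrM ler_piMr // ger0_norm.
  have a2 : 1 / 20 <= a ^+ 2 by nra.
  rewrite normrM (ger0_norm (sqr_ge0 _)) in h.
  by move: h (normr_ge0 (u - v)) a2; move: `|_| (_ ^+ 2) => A B; nra.
have -> : 20 * (a^-1 - 1) - 20 * (b^-1 - 1) = (20 / (a * b)) * (b - a).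
  by field; rewrite !gt_eqF.
rewrite normrM distrC ler_pM // ger0_norm ?divr_ge0 ?mulr_ge0 ?ltW //.
by rewrite ltr_pdivrMr ?mulr_gt0 //; nra.
Qed.

Lemma rough_sphere_dimension_ge :
  ((3 / 2)%:E <= hausdorff_dimension euclidean_distance sphere)%E.
Proof.
have C0 : 0 < 405 * 40 `^ (3 / 2) :> R by rewrite mulr_gt0 ?ltr0n ?powR_gt0 ?ltr0n.
(* Diameters up to [1 / 40] keep [40 * r] in [[0, 1]], the range of [peano_fun_mass]. *)
apply: (@hausdorff_dimension_ge _ _ _ _ sphere_curve _ (1 / 40) _ _ _ C0).
- by lra.
- by lra.
- exact: sphere_curve_in.
move=> U Ueps; have [->|U0] := eqVneq U set0.
  exists set0; split => //; rewrite measure0.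
  by apply: mule_ge0; [rewrite lee_fin (ltW C0)|exact: diameter_power_ge0].
have [r [r0 r1 Ur]] := diameter_EFin _ _ _ Ueps.
have dU u v : U (sphere_curve u) -> U (sphere_curve v) ->
    euclidean_distance (sphere_curve u) (sphere_curve v) <= r.
  by move=> Uu Uv; rewrite -lee_fin -Ur; exact: le_diameter.
pose E := [set u | 0 <= u <= 1 /\ U (sphere_curve u)].
have r40 : 0 <= 40 * r <= 1 by lra.
have [||| V [mV EV muV]] := @peano_fun_mass R E (40 * r) r40.
- by move=> u [/andP[]].
- move=> u v [u01 Uu] [v01 Uv].
  by case: (sphere_curve_expanding u v r u01 v01 (dU _ _ Uu Uv)).
- move=> u v [u01 Uu] [v01 Uv].
  by case: (sphere_curve_expanding u v r u01 v01 (dU _ _ Uu Uv)).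
exists V; split => //; first by move=> u u01 Uu; apply: EV.
apply: le_trans muV _; rewrite /diameter_power (negbTE U0) Ur poweR_EFin -EFinM lee_fin.
by rewrite powRM ?ler0n // mulrA.
Qed.

End RoughSphere.

Theorem proposition5p1 (R : realType) :
  exists d : R * R -> R * R -> R,
    homogeneous_distance square_dilation d /\
    hausdorff_dimension euclidean_distance (unit_sphere d) = (3 / 2)%:E.
Proof.
exists rough_distance; split; first exact: rough_distance_homogeneous.
by apply/eqP; rewrite eq_le rough_sphere_dimension_le rough_sphere_dimension_ge.
Qed.
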